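(* Let $X$ be a reflexive real Banach space with dual space $X'$, let $\{e_i\}_{i\in\mathbb{N}}$ be a Schauder basis of $X$, and let $\{e'_i\}_{i\in\mathbb{N}}\subset X'$ be the corresponding biorthogonal system, i.e. $(e'_i,e_j)=\delta_{ij}$ for all $i,j\in\mathbb{N}$. Let $f_1,f_2,\ldots\in X'$ be an $\omega$-independent sequence. If $$\sum_{i=1}^\infty\|e_i\|\cdot\|f_i-e'_i\|<\infty,$$ then the sequence $\{f_i\}_{i\in\mathbb{N}}$ is a Schauder basis of $X'$.
   Context: For $\varphi\in X'$ and $x\in X$, $(\varphi,x)$ denotes the value $\varphi(x)$; $\delta_{ij}$ is the Kronecker delta; $\|e_i\|$ is the norm in $X$ and $\|f_i-e'_i\|$ is the (dual) norm in $X'$. Infinite sums of vectors are understood as limits of partial sums in norm. A sequence $\{f_i\}\subset X'$ is called $\omega$-independent if for every sequence of real numbers $\{\lambda_i\}_{i\in\mathbb{N}}$, the equality $\sum_{i=1}^\infty\lambda_i f_i=0$ (the series converging in the norm of $X'$ with sum $0$) implies $\lambda_i=0$ for all $i\in\mathbb{N}$. A sequence $\{b_i\}_{i\in\mathbb{N}}$ in a Banach space $Y$ is a Schauder basis of $Y$ if every $y\in Y$ has a unique expansion $y=\sum_{i=1}^\infty c_i b_i$ with scalars $c_i$, convergent in norm. The biorthogonal system $\{e'_i\}$ consists of the coordinate functionals of the basis $\{e_i\}$; since $X$ is reflexive, it is a Schauder basis of $X'$. *)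

(* Defs.v *)
From HB Require Import structures.
From mathcomp Require Import all_boot all_order all_algebra.
From mathcomp Require Import all_classical all_reals all_analysis.

Set Implicit Arguments.
Unset Strict Implicit.
Unset Printing Implicit Defensive.

Import Order.TTheory GRing.Theory Num.Theory.
Import numFieldNormedType.Exports.

Local Open Scope classical_set_scope.
Local Open Scope ring_scope.

Section dual_lmodule.
Context {R : realType} (X : normedModType R).

Definition is_dual : {pred X -> R} :=
  [pred f : X -> R | `[< linear f /\ continuous f >]].

Record dual := Dual { dual_fun :> X -> R ; _ : dual_fun \in is_dual }.

HB.instance Definition _ := [isSub for dual_fun].
HB.instance Definition _ := [Choice of dual by <:].

Lemma is_dual_submod_closed : submod_closed is_dual.
Proof.
split=> [|a f g].
  by apply/asboolP; split=> [b x y|x]; [rewrite /= scaler0 addr0|exact: cvg_cst].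
move=> /asboolP[lf cf] /asboolP[lg cg]; apply/asboolP; split.
  move=> b x y; rewrite !fctE lf lg !scalerDr !scalerA mulrC.
  by rewrite addrACA.
move=> x; apply: (@continuousD _ _ _ (a *: f) g x); last exact: cg.
by apply: (@continuousZl_tmp _ _ _ f a x); exact: cf.
Qed.

HB.instance Definition _ :=
  GRing.isSubmodClosed.Build _ _ is_dual is_dual_submod_closed.
HB.instance Definition _ := [SubChoice_isSubLmodule of dual by <:].

Lemma dual_linear (f : dual) : linear f.
Proof. by case: f => f /= /asboolP[]. Qed.

HB.instance Definition _ (f : dual) :=
  GRing.isLinear.Build R X R _ (f : X -> R) (dual_linear f).

Lemma dual_continuous (f : dual) : continuous f.
Proof. by case: f => f /= /asboolP[]. Qed.

End dual_lmodule.

Section dual_norm.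
Context {R : realType} (X : normedModType R).
Implicit Types (f g : dual X) (x : X).

Definition dual_norm f : R := sup [set `|f x| | x in [set x | `|x| <= 1]].

Lemma dual_bounded f : exists M, forall x, `|f x| <= M * `|x|.
Proof.
have /linear_boundedP/pinfty_ex_gt0[M _ fM] :
  bounded_near (f : {linear X -> R}) (nbhs (0 : X)).
  exact/linear_bounded_continuous/dual_continuous.
by exists M.
Qed.

Lemma has_sup_dual f : has_sup [set `|f x| | x in [set x | `|x| <= 1]].
Proof.
split; first by exists `|f 0|; exists 0 => //=; rewrite normr0.
have [M fM] := dual_bounded f; exists `|M| => _ [x /= x1 <-].
apply: (le_trans (fM x)); apply: (le_trans (ler_norm _)).
by rewrite normrM normr_id ler_piMr.
Qed.

Lemma dual_norm_ge0 f : 0 <= dual_norm f.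
Proof.
apply: (le_trans (normr_ge0 (f 0))).
apply: (ub_le_sup (has_sup_dual f).2).
by exists 0 => //=; rewrite normr0.
Qed.

Lemma le_dual_norm f x : `|f x| <= dual_norm f * `|x|.
Proof.
have [->|x0] := eqVneq x 0; first by rewrite linear0 !normr0 mulr0.
rewrite -ler_pdivrMr ?normr_gt0//.
apply: (ub_le_sup (has_sup_dual f).2); exists (`|x|^-1 *: x) => /=.
  by rewrite normrZ normfV normr_id mulVf ?normr_eq0.
by rewrite linearZ normrZ normfV normr_id mulrC.
Qed.

Lemma dual_norm_le f M : 0 <= M ->
  (forall x, `|f x| <= M * `|x|) -> dual_norm f <= M.
Proof.
move=> M0 fM; apply: ge_sup; first exact: (has_sup_dual f).1.
by move=> _ [x /= x1 <-]; rewrite (le_trans (fM x))// ler_piMr.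
Qed.

Lemma ler_dual_normD f g : dual_norm (f + g) <= dual_norm f + dual_norm g.
Proof.
apply: dual_norm_le => [|x]; first by rewrite addr_ge0 ?dual_norm_ge0.
by rewrite (le_trans (ler_normD _ _))// mulrDl lerD ?le_dual_norm.
Qed.

Lemma dual_normZ (a : R) f : dual_norm (a *: f) = `|a| * dual_norm f.
Proof.
have le_normZ (b : R) g : dual_norm (b *: g) <= `|b| * dual_norm g.
  apply: dual_norm_le => [|x]; first by rewrite mulr_ge0 ?dual_norm_ge0.
  by rewrite normrZ -mulrA ler_wpM2l ?le_dual_norm.
apply/eqP; rewrite eq_le le_normZ/=.
have [->|a0] := eqVneq a 0; first by rewrite normr0 mul0r dual_norm_ge0.
rewrite -ler_pdivlMl ?normr_gt0// -normfV.
by rewrite -{1}(scalerK a0 f) le_normZ.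
Qed.

Lemma dual_norm0_eq0 f : dual_norm f = 0 -> f = 0.
Proof.
move=> f0; apply/val_inj/funext => x; apply/normr0_eq0/eqP.
by rewrite eq_le normr_ge0 andbT (le_trans (le_dual_norm f x))// f0 mul0r.
Qed.

HB.instance Definition _ := Lmodule_isNormed.Build R (dual X)
  ler_dual_normD dual_normZ dual_norm0_eq0.

Lemma dual_normE f :
  `|f| = sup [set `|f x| | x in [set x : X | `|x| <= 1]].
Proof. by []. Qed.

End dual_norm.

Section dual_complete.
Context {R : realType} (X : normedModType R).

Lemma dual_cauchy_cvg (F : set_system (dual X)) :
  ProperFilter F -> cauchy F -> cvg F.
Proof.
move=> FF /cauchyP Fc.
have Fx x : cvg ((fun f : dual X => f x) @ F).
  apply: cauchy_cvg; apply/cauchy_exP => e e0.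
  have d0 : 0 < e / (`|x| + 1) by rewrite divr_gt0// ltr_wpDl.
  have [f0] := Fc _ d0; rewrite -ball_normE /= => Ff0.
  exists (f0 x); rewrite -ball_normE /=; apply: filterS Ff0 => f /= ff0.
  rewrite (_ : f0 x - f x = (f0 - f) x)//.
  apply: (le_lt_trans (le_dual_norm _ _)).
  apply: (@le_lt_trans _ _ (e / (`|x| + 1) * `|x|)).
    by rewrite ler_wpM2r// ltW.
  by rewrite -mulrA gtr_pMr// mulrC ltr_pdivrMr ?ltr_wpDl// mul1r ltrDl.
pose L x : R := lim ((fun f : dual X => f x) @ F).
have LE x : (fun f : dual X => f x) @ F --> L x by exact: Fx.
have Ll : linear L.
  move=> a x y; apply: cvg_lim => //.
  under eq_fun do rewrite linearP.
  by apply: cvgD; [apply: cvgZl_tmp; exact: LE|exact: LE].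
have FL e : 0 < e -> F [set f : dual X | forall x, `|L x - f x| <= e * `|x|].
  move=> e0; have e20 : 0 < e / 2 by rewrite divr_gt0.
  have [f0] := Fc _ e20; rewrite -ball_normE /= => Ff0.
  apply: filterS (Ff0) => f /= ff0 x; apply/ler_addgt0Pr => d d0.
  have /cvgrPdist_lt/(_ d d0) Fd := LE x.
  have [g [/= gf0 gL]] := filter_ex (filterI Ff0 Fd).
  rewrite -(subrKA (g x)) addrC (le_trans (ler_normD _ _))//.
  rewrite lerD//; last exact: ltW.
  rewrite (_ : g x - f x = (g - f) x)//.
  rewrite (le_trans (le_dual_norm _ _))// ler_wpM2r//.
  rewrite (_ : dual_norm _ = `|g - f|)//.
  rewrite -(subrKA f0) (le_trans (ler_normD _ _))//.
  by rewrite [leRHS]splitr lerD// ltW// distrC.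
pose Lin : {linear X -> R} := HB.pack L (GRing.isLinear.Build R X R _ L Ll).
have Lc : continuous L.
  have [f /= fL] := filter_ex (FL 1 ltr01).
  apply: (@bounded_linear_continuous _ _ _ Lin).
  apply/linear_boundedP.
  apply: filterS (nbhs_pinfty_ge (num_real (1 + dual_norm f))) => M leM x /=.
  rewrite -(subrK (f x) (L x)) (le_trans (ler_normD _ _))//.
  rewrite (le_trans (lerD (fL x) (le_dual_norm f x)))// -mulrDl.
  by rewrite ler_wpM2r.
have LP : L \in @is_dual R X by apply/asboolP.
apply/cvg_ex; exists (Dual LP); apply/cvgrPdist_le => e e0.
apply: filterS (FL e e0) => f fL.
by apply: dual_norm_le; [exact: ltW|move=> x; exact: fL].
Qed.

HB.instance Definition _ := Uniform_isComplete.Build (dual X) dual_cauchy_cvg.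

End dual_complete.

Section bidual.
Context {R : realType} (X : normedModType R).

Definition bidual_eval (x : X) (f : dual X) : R := f x.

Lemma is_dual_bidual_eval x : bidual_eval x \in @is_dual R (dual X).
Proof.
have lx : linear (bidual_eval x) by [].
apply/asboolP; split=> //.
pose ex : {linear dual X -> R} :=
  HB.pack (bidual_eval x) (GRing.isLinear.Build R (dual X) R _ _ lx).
apply: (@bounded_linear_continuous _ _ _ ex).
apply/linear_boundedP.
apply: filterS (nbhs_pinfty_ge (num_real `|x|)) => M leM f /=.
rewrite (le_trans (le_dual_norm f x))// mulrC.
exact: (ler_wpM2r (dual_norm_ge0 f) leM).
Qed.

Definition to_bidual (x : X) : dual (dual X) := Dual (is_dual_bidual_eval x).

(* Reflexivity is surjectivity of the canonical map to_bidual, as opposed to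
   the mere existence of some isomorphism between X and its bidual. *)
Definition reflexive_space := range to_bidual = [set: dual (dual X)].

End bidual.

Section sequences_in_normed_spaces.
Context {R : realType} (Y : normedModType R).

Definition schauder_basis (b : nat -> Y) :=
  forall y : Y, exists! c : nat -> R,
    series (fun i => c i *: b i) @ \oo --> y.

Definition omega_independent (f : nat -> Y) :=
  forall l : nat -> R,
    series (fun i => l i *: f i) @ \oo --> (0 : Y) -> forall i, l i = 0.

End sequences_in_normed_spaces.

(* Main.v *)
Require Import Defs.
From HB Require Import structures.
From mathcomp Require Import all_boot all_order all_algebra.
From mathcomp Require Import all_classical all_reals all_analysis.

Set Implicit Arguments.
Unset Strict Implicit.
Unset Printing Implicit Defensive.

Import Order.TTheory GRing.Theory Num.Theory.
Import numFieldNormedType.Exports.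

Local Open Scope classical_set_scope.
Local Open Scope ring_scope.

(** Put g_i = f_i - e'_i and let K be the nuclear operator K phi = sum_i
    phi(e_i) g_i on X'; the series converges absolutely by the summability
    hypothesis, since |phi(e_i) g_i| <= |phi| |e_i| |g_i|. As phi = sum_i
    phi(e_i) e'_i ([coordinates_expand_dual]), the operator T = I + K
    satisfies T phi = sum_i phi(e_i) f_i. If T phi = 0, omega-independence
    makes every phi(e_i) vanish, hence phi = 0: T is injective. A Fredholm
    argument turns this into surjectivity, so every psi = T phi has the
    expansion sum_i phi(e_i) f_i; uniqueness of expansions is
    omega-independence again.

    Fredholm theory for K is elementary. Beyond some rank n the tail of the
    series has operator norm at most 1/2, so I + tail is onto by the
    contraction principle ([surjective_id_add_contraction]); the n remaining
    terms have finite rank, and for a finite-rank perturbation of a surjective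
    operator, injective implies surjective by linear algebra in dimension n
    ([surjective_add_finite_rank]).

    Reflexivity enters through the expansion phi = sum_i phi(e_i) e'_i. If it
    fails, the remainders phi - sum_(i < n) phi(e_i) e'_i stay away from 0 in
    norm infinitely often. Testing them on vectors x of the unit ball and
    moving the projection over to X gives vectors y_N = x - sum_(i < n)
    e'_i(x) e_i, n >= N, on which |phi| is bounded below, while e'_i(y_N) = 0
    for i < N. They are bounded by the uniform boundedness principle, so by
    reflexivity they converge weakly along an ultrafilter
    ([reflexive_weak_cvg]) to some z. All coordinates of z are 0, so z = 0,
    although |phi(z)| is bounded below. *)

(** * Perturbations of surjective operators *)

(** A solution of x + K x = y is a fixed point of the contraction y - K. *)
Lemma surjective_id_add_contraction (R : realType) (Y : completeNormedModType R)
    (K : {linear Y -> Y}) (q : {nonneg R}) : q%:num < 1 ->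
  (forall x, `|K x| <= q%:num * `|x|) -> forall y, exists x, x + K x = y.
Proof.
move=> q1 Kq y.
have ctr : is_contraction ('totalfun_setT (fun x => y - K x)).
  exists q; split=> // -[x1 x2] _ /=.
  rewrite /totalfun_ opprB addrC subrKA -linearB.
  by rewrite (le_trans (Kq _))// distrC.
have [|x _ xE] := banach_fixed_point ctr closedT; first by exists 0.
by exists x; rewrite [X in X + _]xE /totalfun_ subrK.
Qed.

(** Choose w and h_i with S w = y and S h_i = g_i, and look for a solution of
    the form w - sum_i c_i h_i: it is one as soon as its image under each u_j
    is c_j. This is an n by n linear system for c, whose matrix is invertible
    because z = sum_i c_i h_i, for c in its kernel, satisfies u_j(z) = - c_j and
    hence S z + sum_i u_i(z) g_i = 0, so that z = 0 and then c = 0. *)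
Lemma surjective_add_finite_rank (F : fieldType) (V : lmodType F)
    (S : {linear V -> V}) n (u : 'I_n -> {scalar V}) (g : 'I_n -> V) :
  (forall y, exists x, S x = y) ->
  (forall x, S x + \sum_i u i x *: g i = 0 -> x = 0) ->
  forall y, exists x, S x + \sum_i u i x *: g i = y.
Proof.
move=> Ssurj Tinj y; have [w Sw] := Ssurj y.
have [h Sh] := choice (fun i => Ssurj (g i)).
pose A : 'M[F]_n := 1%:M + \matrix_(i, j) u j (h i).
have AE (c : 'rV[F]_n) j : (c *m A) 0 j = c 0 j + u j (\sum_i c 0 i *: h i).
  rewrite mulmxDr mulmx1 !mxE linear_sum; congr (_ + _).
  by apply: eq_bigr => i _; rewrite mxE linearZ.
have SE (c : 'rV[F]_n) :
    S (\sum_i c 0 i *: h i) = \sum_i c 0 i *: g i.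
  by rewrite linear_sum; apply: eq_bigr => i _; rewrite linearZ/= Sh.
have Aunit : A \in unitmx.
  rewrite -row_free_unit -kermx_eq0; apply/rowV0P => c /sub_kermxP cA0.
  set z := \sum_i c 0 i *: h i.
  have cE j : u j z = - c 0 j.
    by apply/eqP; rewrite -addr_eq0 addrC -AE cA0 mxE.
  have z0 : z = 0.
    apply: Tinj; rewrite SE -big_split big1// => i _ /=.
    by rewrite cE scaleNr subrr.
  by apply/rowP => j; rewrite mxE -[LHS]opprK -cE z0 linear0 oppr0.
pose c := (\row_j u j w) *m invmx A.
have cE j : u j (w - \sum_i c 0 i *: h i) = c 0 j.
  have := AE c j; rewrite mulmxKV// mxE => wE.
  by rewrite linearB/= wE addrK.
exists (w - \sum_i c 0 i *: h i); rewrite linearB/= SE Sw.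
by under [X in _ + X]eq_bigr do rewrite cE; rewrite subrK.
Qed.

(** * Nuclear series *)

(** Both the convergence of K phi = sum_i phi(a_i) g_i and the operator norm
    estimate |K| <= sum_i |a_i| |g_i| come from the domination
    |phi(a_i) g_i| <= |phi| |a_i| |g_i|. Applied to a tail, C can be made
    small. *)
Lemma bounded_nuclear_series (R : realType) (X : normedModType R)
    (Y : completeNormedModType R) (a : nat -> X) (g : nat -> Y) (C : R) :
  (forall m, series (fun i => `|a i| * `|g i|) m <= C) ->
  forall phi : dual X, let s := series (fun i => phi (a i) *: g i) in
  cvgn s /\ `|limn s| <= C * `|phi|.
Proof.
move=> agC phi s.
have sC m : [normed s] m <= C * `|phi|.
  rewrite /series /=.
  apply: (@le_trans _ _ (\sum_(0 <= i < m) `|a i| * `|g i| * `|phi|)).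
    apply: ler_sum => i _; rewrite normrZ mulrAC ler_wpM2r// mulrC.
    exact: le_dual_norm.
  by rewrite -mulr_suml ler_wpM2r//; exact: agC.
have ncvg : cvgn [normed s].
  apply: nondecreasing_is_cvgn; last by exists (C * `|phi|) => _ [m _ <-].
  exact: (@nondecreasing_series _ (fun i => `|phi (a i) *: g i|) xpredT 0%N
    (fun i _ _ => normr_ge0 _)).
split; first exact: normed_cvg.
apply: (le_trans (lim_series_norm ncvg)); apply: limr_le => //.
exact: nearW.
Qed.

Lemma series_shiftE (V : zmodType) (u : nat -> V) (n m : nat) :
  series (fun i => u (i + n)%N) m = \sum_(n <= i < m + n) u i.
Proof. by rewrite -{1}[n in RHS]add0n big_addn addnK. Qed.

Lemma cvg_series_shift (R : realType) (Y : normedModType R) (u : nat -> Y)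
    (n : nat) (l : Y) :
  series (fun i => u (i + n)%N) @ \oo --> l ->
  series u @ \oo --> l + \sum_(i < n) u i.
Proof.
move=> ul; rewrite -(cvg_shiftn n) [X in X @ \oo --> _](_ : _ = fun m =>
    series (fun i => u (i + n)%N) m + \sum_(i < n) u i); last first.
  apply/funext => m; rewrite series_shiftE /series/=.
  by rewrite (big_cat_nat (n := n)) ?leq_addl//= big_mkord addrC.
by apply: cvgD => //; exact: cvg_cst.
Qed.

Lemma linear_limn_series_scale (R : realType) (X Y : normedModType R)
    (a : nat -> X) (g : nat -> Y) :
  (forall phi : dual X, cvgn (series (fun i => phi (a i) *: g i))) ->
  linear (fun phi : dual X => limn (series (fun i => phi (a i) *: g i))).
Proof.
move=> cv c phi psi; apply: cvg_lim => //.
rewrite [X in X @ \oo --> _](_ : _ = fun m =>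
    c *: series (fun i => phi (a i) *: g i) m
    + series (fun i => psi (a i) *: g i) m); last first.
  apply/funext => m; rewrite /series/= scaler_sumr -big_split.
  by apply: eq_bigr => i _ /=; rewrite scalerA -scalerDl.
by apply: cvgD; [apply: cvgZl_tmp; exact: cv|exact: cv].
Qed.

Lemma small_series_tail (R : realType) (u : nat -> R) (eps : R) :
  0 < eps -> cvgn (series u) ->
  exists n, forall m, series (fun i => u (i + n)%N) m <= eps.
Proof.
move=> eps0 /cauchy_cvgP/cauchy_seriesP/(_ _ eps0)[[A B]/=].
move=> [[n _ An] [k _ Bk]] AB; exists (maxn n k) => m.
rewrite series_shiftE.
apply/ltW/(le_lt_trans (ler_norm _)); apply: (AB (_, _)); split => /=.
  by apply: An; rewrite /= leq_maxl.
by apply: Bk; rewrite /= (leq_trans (leq_maxr n k))// leq_addl.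
Qed.

(** * Weak convergence along ultrafilters *)

Lemma ultra_fmap (T T' : Type) (f : T -> T') (U : set_system T) :
  UltraFilter U -> UltraFilter (f @ U).
Proof.
move=> UU; split; first exact: fmap_proper_filter.
move=> G GF UG; apply/seteqP; split=> // A GA.
have [//|UAc] := in_ultra_setVsetC (f @^-1` A) UU.
have /filter_ex[x []//] : G (A `&` ~` A) by apply: filterI => //; exact: UG.
Qed.

(** Limits along an ultrafilter exist for every bounded real sequence and are
    linear in the sequence, so the limits of phi (y n) assemble into a
    bounded functional F on the dual; reflexivity represents F by a point. *)
Lemma reflexive_weak_cvg (R : realType) (X : normedModType R) (y : nat -> X)
    (C : R) : reflexive_space X -> (forall n, `|y n| <= C) ->
  exists2 U : set_system nat, UltraFilter U /\ \oo `<=` U &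
  exists x, forall phi : dual X, phi (y n) @[n --> U] --> phi x.
Proof.
move=> refl yC; have [U [UU ooU]] := ultraFilterLemma eventually_filter.
exists U => //.
have C0 : 0 <= C := le_trans (normr_ge0 _) (yC 0).
have phiC (phi : dual X) n : `|phi (y n)| <= C * `|phi|.
  by rewrite (le_trans (le_dual_norm _ _))// mulrC ler_wpM2r// dual_norm_ge0.
have cvU (phi : dual X) : cvg (phi (y n) @[n --> U]).
  have := @segment_compact R (- (C * `|phi|)) (C * `|phi|).
  rewrite compact_ultra => /(_ _ (ultra_fmap (phi \o y) UU))[].
    by apply: nearW => n /=; rewrite in_itv/= -ler_norml.
  by move=> p [_ pU]; apply/cvg_ex; exists p.
pose F (phi : dual X) : R := lim (phi (y n) @[n --> U]).
have Flin : linear F.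
  move=> c phi psi; apply: cvg_lim => //=.
  by apply: cvgD; [apply: cvgZl_tmp; exact: cvU|exact: cvU].
pose FL : {linear dual X -> R} :=
  HB.pack F (GRing.isLinear.Build R (dual X) R _ F Flin).
have FC phi : `|F phi| <= C * `|phi|.
  rewrite /F -lim_norm//; apply: limr_le; first exact: is_cvg_norm.
  exact: nearW.
have Fcont : continuous F.
  apply: (@bounded_linear_continuous _ _ _ FL); apply/linear_boundedP.
  apply: filterS (nbhs_pinfty_ge (num_real C)) => M CM phi /=.
  by rewrite (le_trans (FC phi))// ler_wpM2r.
have FP : F \in @is_dual R (dual X) by apply/asboolP.
have [x _ xF] : range (@to_bidual R X) (Dual FP) by rewrite refl.
by exists x => phi; rewrite -[phi x]/(to_bidual x phi) xF; exact: cvU.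
Qed.

(** * The coordinate functionals of a basis of a reflexive space *)

Section basis_coordinates.
Context (R : realType) (X : completeNormedModType R).
Context (e : nat -> X) (e' : nat -> dual X).
Context (e_basis : schauder_basis e).
Context (e'e : forall i j, e' i (e j) = (i == j)%:R).

Lemma coord_series (c : nat -> R) (i n : nat) : (i < n)%N ->
  e' i (series (fun k => c k *: e k) n) = c i.
Proof.
move=> ni; rewrite /series/= big_mkord linear_sum (bigD1 (Ordinal ni))//=.
rewrite linearZ/= e'e eqxx -[c i *: _]/(c i * _) mulr1 big1 ?addr0// => j jni.
rewrite linearZ/= (_ : e' i (e j) = 0) ?scaler0//.
by rewrite e'e; case: eqP => // ij; rewrite -val_eqE/= ij eqxx in jni.
Qed.

(** The coefficients in any expansion of x are forced: the continuous functional
    e'_i is eventually constant, equal to the i-th one, on its partial sums. *)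
Lemma basis_expansion x : series (fun i => e' i x *: e i) @ \oo --> x.
Proof.
have [c [cx _]] := e_basis x.
rewrite (_ : (fun i => _) = (fun i => c i *: e i))//.
apply/funext => i; congr (_ *: _).
apply: (@cvg_unique _ (@norm_hausdorff _ R)
  (e' i (series (fun k => c k *: e k) n) @[n --> \oo])).
  exact: (continuous_cvg _ (@dual_continuous _ _ (e' i) x) cx).
by apply: cvg_near_cst; exists i.+1 => // n /=; exact: coord_series.
Qed.

(** Finiteness of the basis constant: the partial-sum projections are
    continuous, as the e'_i are, and pointwise bounded, as the expansions
    converge, so the uniform boundedness principle applies. *)
Lemma partial_sums_bounded : exists C, forall n x, `|x| <= 1 ->
  `|series (fun i => e' i x *: e i) n| <= C.
Proof.
pose P n x := series (fun i => e' i x *: e i) n.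
have Plin n : linear (P n).
  move=> c x y; rewrite /P /series/= scaler_sumr -big_split.
  by apply: eq_bigr => i _ /=; rewrite linearP scalerA -scalerDl.
have Pbnd n : bounded_fun_norm (P n).
  move=> r; exists (\sum_(0 <= i < n) `|e' i| * r * `|e i|) => x xr.
  rewrite (le_trans (ler_norm_sum _ _ _))//; apply: ler_sum => i _.
  rewrite normrZ ler_wpM2r// (le_trans (le_dual_norm _ _))// ler_wpM2l//.
  exact: dual_norm_ge0.
case: (@Banach_Steinhauss _ X X (range P) _ _ 1) => [|x|C PC].
- by move=> _ [n _ <-]; split.
- have /cvgP/cvg_seq_bounded/pinfty_ex_gt0[M _ PM] := @basis_expansion x.
  by exists M => _ [n _ <-]; exact: PM.
- by exists C => n x; apply: (PC (P n)); exists n.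
Qed.

(** The partial sums of the expansion of phi are phi composed with the
    partial-sum projections P n, so a remainder evaluates at x as
    phi (x - P n x). The vectors x - P n x have no coordinates below n, which
    makes a weak limit of them vanish. *)
Lemma coordinates_expand_dual : reflexive_space X ->
  forall phi : dual X, series (fun i => phi (e i) *: e' i) @ \oo --> phi.
Proof.
move=> refl phi; have [C PC] := partial_sums_bounded.
pose P n x := series (fun i => e' i x *: e i) n.
apply/cvgrPdist_lt => eps eps0; apply: contrapT => Nnear.
have tails N : exists y, [/\ `|y| <= 1 + C, eps / 2 <= `|phi y| &
    forall i, (i < N)%N -> e' i y = 0].
  apply: contrapT => Ny; apply: Nnear; exists N => // n /= Nn.
  apply: (@le_lt_trans _ _ (eps / 2)); last first.
    by rewrite ltr_pdivrMr// ltr_pMr// ltr1n.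
  rewrite dual_normE; apply: ge_sup; first exact: (has_sup_dual _).1.
  move=> _ [x /= x1 <-].
  have phiP : to_bidual x (phi - series (fun i => phi (e i) *: e' i) n) =
      phi (x - P n x).
    rewrite !linearB; congr (_ - _).
    rewrite /P /series !linear_sum; apply: eq_bigr => i _.
    by rewrite !linearZ; exact: mulrC.
  rewrite [X in `|X|](_ : _ = phi (x - P n x)); last exact: phiP.
  apply: contrapT => /negP; rewrite -ltNge => /ltW lephi; apply: Ny.
  exists (x - P n x); split=> //.
    by rewrite (le_trans (ler_normB _ _))// lerD// PC.
  by move=> i iN; rewrite linearB/= coord_series ?subrr// (leq_trans iN).
have {}[y ytail] := choice tails.
have [U [UU ooU] [x Ux]] :=
  reflexive_weak_cvg refl (fun n => let: And3 yC _ _ := ytail n in yC).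
have x0 : x = 0.
  rewrite -[LHS](cvg_lim (@norm_hausdorff _ X) (@basis_expansion x)).
  rewrite (_ : series _ = cst 0); first exact: lim_cst.
  apply/funext => n; rewrite /series/= big1// => i _.
  suff -> : e' i x = 0 by rewrite scale0r.
  rewrite -[LHS](cvg_lim (@norm_hausdorff _ R) (Ux (e' i))).
  apply: cvg_lim => //; apply: cvg_near_cst; apply: ooU.
  exists i.+1 => // m /= im.
  by case: (ytail m) => _ _; exact.
have : eps / 2 <= `|phi x|.
  rewrite -(cvg_lim _ (cvg_norm (Ux phi)))//.
  apply: limr_ge; first by apply: (cvgP _ (cvg_norm (Ux phi))).
  by apply: nearW => n; case: (ytail n).
by rewrite x0 linear0 normr0 leNgt divr_gt0.
Qed.

End basis_coordinates.

(** * Sequences close to the coordinate functionals *)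

Theorem theorem2 (R : realType) (X : completeNormedModType R)
    (e : nat -> X) (e' : nat -> dual X) (f : nat -> dual X) :
  reflexive_space X ->
  schauder_basis e ->
  (forall i j : nat, e' i (e j) = (i == j)%:R) ->
  omega_independent f ->
  (\sum_(0 <= i <oo) (`|e i| * `|f i - e' i|)%:E < +oo)%E ->
  schauder_basis f.
Proof.
move=> refl e_basis e'e f_indep ef_fin.
pose g i := f i - e' i.
have expand := coordinates_expand_dual e_basis e'e refl.
have [n tail_half] : exists n, forall m,
    series (fun i => `|e (i + n)%N| * `|g (i + n)%N|) m <= 1 / 2.
  apply: (@small_series_tail _ (fun i => `|e i| * `|g i|)) => //.
  by apply: nnseries_is_cvg => // i; rewrite mulr_ge0.
have tail_cvg := bounded_nuclear_series tail_half.
(* [K] is only the tail, from rank [n] on, of the full nuclear operator. *)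
pose K (phi : dual X) :=
  limn (series (fun i => phi (e (i + n)%N) *: g (i + n)%N)).
have Klin : linear K.
  by apply: linear_limn_series_scale => phi; exact: (tail_cvg phi).1.
pose KL : {linear dual X -> dual X} :=
  HB.pack K (GRing.isLinear.Build R (dual X) (dual X) _ K Klin).
have Slin : linear (fun phi => phi + K phi).
  by move=> c phi psi; rewrite Klin scalerDr addrACA.
pose S : {linear dual X -> dual X} :=
  HB.pack (fun phi => phi + K phi)
    (GRing.isLinear.Build R (dual X) (dual X) _ _ Slin).
have Ssurj psi : exists phi, S phi = psi.
  have := @surjective_id_add_contraction R (dual X) KL (2^-1)%:nng.
  apply => [|phi] /=; first by rewrite invf_lt1// ltr1n.
  by rewrite (le_trans (tail_cvg phi).2)// div1r.
have f_series (phi : dual X) : series (fun i => phi (e i) *: f i) @ \oo -->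
    S phi + \sum_(i < n) phi (e i) *: g i.
  have gK : series (fun i => phi (e i) *: g i) @ \oo -->
      K phi + \sum_(i < n) phi (e i) *: g i.
    apply: (@cvg_series_shift _ _ (fun i => phi (e i) *: g i)).
    exact: (tail_cvg phi).1.
  rewrite (_ : series _ = fun m => series (fun i => phi (e i) *: e' i) m
                                  + series (fun i => phi (e i) *: g i) m).
    by rewrite -[S phi]/(phi + K phi) -addrA; apply: cvgD => //; exact: expand.
  apply/funext => m; rewrite /series/= -big_split.
  by apply: eq_bigr => i _ /=; rewrite -scalerDr subrKC.
have f_total (psi : dual X) : exists phi : dual X,
    series (fun i => phi (e i) *: f i) @ \oo --> psi.
  have := @surjective_add_finite_rank R (dual X) S n
    (fun i => to_bidual (e i)) g Ssurj.
  (* The perturbed operator is injective because the f_i are independent. *)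
  case/(_ _ psi) => [phi Tphi0|phi phiE]; last by exists phi; rewrite -phiE.
  have := f_series phi; rewrite Tphi0 => /f_indep phie0.
  rewrite -[LHS](cvg_lim (@norm_hausdorff _ (dual X)) (expand phi)).
  rewrite (_ : series _ = cst 0); first exact: lim_cst.
  by apply/funext => m; rewrite /series/= big1// => i _; rewrite phie0 scale0r.
move=> psi; have [phi phif] := f_total psi.
exists (fun i => phi (e i)); split=> // c cf; apply/funext => i.
apply/eqP; rewrite -subr_eq0; apply/eqP; move: i; apply: f_indep.
rewrite -(subrr psi).
rewrite (_ : series _ = fun m => series (fun i => phi (e i) *: f i) m
                                - series (fun i => c i *: f i) m).
  exact: cvgB.
apply/funext => m; rewrite /series/= -sumrB.
by apply: eq_bigr => i _; rewrite scalerBl.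
Qed.
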